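(* The Liouville-\c{T}i\c{t}eica PDE $\omega_{uv}=e^{\omega}$ and the \c{T}i\c{t}eica PDE $\omega_{uv}=e^{\omega}-e^{-2\omega}$, for an unknown function $\omega=\omega(u,v)$, are Euler-Lagrange equations, with associated Lagrangians respectively $$L_1(u,v,\omega^{(1)})=-\frac12\omega_u\omega_v-e^{\omega}$$ and $$L_2(u,v,\omega^{(1)})=-\frac12\omega_u\omega_v-e^{\omega}-\frac12e^{-2\omega}.$$
   Context: Here $\omega^{(1)}=(\omega,\omega_u,\omega_v)$. For a Lagrangian $L(u,v,\omega^{(1)})$ the Euler-Lagrange equation is $E(L)=\frac{\partial L}{\partial\omega}-D_u\left(\frac{\partial L}{\partial\omega_u}\right)-D_v\left(\frac{\partial L}{\partial\omega_v}\right)=0$, where $D_u,D_v$ are total derivatives. A PDE $\Delta(u,v,\omega^{(2)})=0$ is an Euler-Lagrange equation with associated Lagrangian $L$ if it is identical to $E(L)=0$, so that the solutions of the PDE are exactly the solutions of $E(L)=0$. *)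

(* Defs.v *)
From HB Require Import structures.
From mathcomp Require Import all_boot all_order all_algebra.
From mathcomp Require Import all_classical all_reals all_analysis.

Set Implicit Arguments.
Unset Strict Implicit.
Unset Printing Implicit Defensive.

Import Order.TTheory GRing.Theory Num.Theory.
Import numFieldNormedType.Exports.

Local Open Scope classical_set_scope.
Local Open Scope ring_scope.

Section Calculus.
Variables (R : realType) (n : nat).
Implicit Types (F : 'rV[R]_n.+1 -> R) (A : set 'rV[R]_n.+1).

Definition partial (i : 'I_n.+1) F : 'rV[R]_n.+1 -> R :=
  fun x => 'D_(delta_mx 0 i) F x.

(* Meant for open A: derivatives at the points of A are two-sided. *)
Fixpoint class_C (k : nat) A F : Prop :=
  (forall x, A x -> {for x, continuous F}) /\
  if k is k'.+1 then
    forall i : 'I_n.+1,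
      (forall x, A x -> derivable F x (delta_mx 0 i)) /\
      class_C k' A (partial i F)
  else True.

Definition smooth F : Prop := forall k, class_C k setT F.

End Calculus.

(* Coordinates (u, v) of the base; coordinates (u, v, w, w_u, w_v) of the
   first jet space; a second-order jet is a first-order one (its left block)
   followed by (w_uu, w_uv, w_vv). *)
Definition bu : 'I_2 := @Ordinal 2 0 isT.
Definition bv : 'I_2 := @Ordinal 2 1 isT.

Definition ju  : 'I_5 := @Ordinal 5 0 isT.
Definition jv  : 'I_5 := @Ordinal 5 1 isT.
Definition jw  : 'I_5 := @Ordinal 5 2 isT.
Definition jwu : 'I_5 := @Ordinal 5 3 isT.
Definition jwv : 'I_5 := @Ordinal 5 4 isT.

Definition juu : 'I_3 := @Ordinal 3 0 isT.
Definition juv : 'I_3 := @Ordinal 3 1 isT.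
Definition jvv : 'I_3 := @Ordinal 3 2 isT.

Section EulerLagrange.
Variable R : realType.

Definition jet1 : Type := 'rV[R]_5.
Definition jet2 : Type := 'rV[R]_(5 + 3).

Definition order1 (z : jet2) : 'rV[R]_5 := lsubmx z.
Definition order2 (z : jet2) : 'rV[R]_3 := rsubmx z.

Definition total_u (F : jet1 -> R) (z : jet2) : R :=
  partial ju F (order1 z)
  + order1 z 0 jwu * partial jw F (order1 z)
  + order2 z 0 juu * partial jwu F (order1 z)
  + order2 z 0 juv * partial jwv F (order1 z).

Definition total_v (F : jet1 -> R) (z : jet2) : R :=
  partial jv F (order1 z)
  + order1 z 0 jwv * partial jw F (order1 z)
  + order2 z 0 juv * partial jwu F (order1 z)
  + order2 z 0 jvv * partial jwv F (order1 z).

Definition euler (L : jet1 -> R) (z : jet2) : R :=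
  partial jw L (order1 z)
  - total_u (partial jwu L) z
  - total_v (partial jwv L) z.

Definition prolong2 (w : 'rV[R]_2 -> R) (p : 'rV[R]_2) : jet2 :=
  row_mx
    (\row_(i < 5) [:: p 0 bu; p 0 bv; w p; partial bu w p; partial bv w p]`_i)
    (\row_(i < 3) [:: partial bu (partial bu w) p;
                      partial bv (partial bu w) p;
                      partial bv (partial bv w) p]`_i).

(* A differential function D : jet2 -> R stands for the PDE D = 0. *)
Definition solution (D : jet2 -> R) (A : set 'rV[R]_2) (w : 'rV[R]_2 -> R) :
    Prop :=
  [/\ open A, class_C 2 A w & forall p, A p -> D (prolong2 w p) = 0].

(* The last clause follows from the second one; it is the intended meaning
   of the identity of the two equations. *)
Definition euler_lagrange_eq (D : jet2 -> R) (L : jet1 -> R) : Prop :=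
  [/\ smooth L,
      forall z, D z = euler L z
    & forall A w, solution D A w <-> solution (euler L) A w].

(* An equation lhs = rhs is encoded as lhs - rhs. *)
Definition liouville_titeica (z : jet2) : R :=
  order2 z 0 juv - expR (order1 z 0 jw).

Definition titeica (z : jet2) : R :=
  order2 z 0 juv - (expR (order1 z 0 jw) - expR (- 2 * order1 z 0 jw)).

Definition lagrangian1 (x : jet1) : R :=
  - (1 / 2) * x 0 jwu * x 0 jwv - expR (x 0 jw).

Definition lagrangian2 (x : jet1) : R :=
  - (1 / 2) * x 0 jwu * x 0 jwv - expR (x 0 jw)
  - 1 / 2 * expR (- 2 * x 0 jw).

End EulerLagrange.

(* Main.v *)
(* Both Lagrangians belong to the finite-dimensional space of functions
   a w_u w_v + b w_u + c w_v + d + e exp(w) + f exp(-2 w) on the first jet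
   space.  This space is stable under all partial derivatives, which gives
   smoothness by induction and turns the Euler operator into a computation on
   the coefficients. *)
Require Import Defs.
From mathcomp Require Import all_boot all_order all_algebra.
From mathcomp Require Import all_classical all_reals all_analysis.
From mathcomp Require Import ring.

Set Implicit Arguments.
Unset Strict Implicit.
Unset Printing Implicit Defensive.

Import Order.TTheory GRing.Theory Num.Theory.
Import numFieldNormedType.Exports.

Local Open Scope classical_set_scope.
Local Open Scope ring_scope.

Section DirectionalDerivatives.
Variable R : realType.

(** A coordinate is an entry of the identity map, whose derivative along [v] is [v], and
    matrix-valued maps are differentiated entrywise. *)
Lemma is_derive_coord m n (x v : 'M[R]_(m, n)) i j :
  is_derive x v (fun y : 'M[R]_(m, n) => y i j) (v i j).
Proof.
have did := @derivable_id _ 'M[R]_(m, n) x v.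
apply: DeriveDef; first exact: (derivable_mxP id x v).1.
by have := derive_mx did; rewrite derive_id => /matrixP/(_ i j); rewrite mxE.
Qed.

Lemma is_derive_expR_comp (V : normedModType R) (f : V -> R) (x v : V) :
  differentiable f x ->
  is_derive x v (expR \o f) (expR (f x) * 'D_v f x).
Proof.
move=> df.
have dexp : differentiable (@expR R) (f x).
  exact/derivable1_diffP/derivable_expR.
have dcomp : differentiable (expR \o f) x by exact: differentiable_comp.
apply: DeriveDef; first exact: diff_derivable.
(* Directional derivatives are turned into differentials, which compose; that of [expR] at [f x] is
   multiplication by [expR (f x)]. *)
by rewrite !deriveE // diff_comp //= diff1E // derive1E derive_val mulrC.
Qed.

End DirectionalDerivatives.

Section ExpJet.
Variable R : realType.
Implicit Types (a b c d e f : R) (x v : jet1 R).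

Definition exp_jet a b c d e f : jet1 R -> R := fun x =>
  a * x 0 jwu * x 0 jwv + b * x 0 jwu + c * x 0 jwv + d
  + e * expR (x 0 jw) + f * expR (- 2 * x 0 jw).

Lemma differentiable_exp_jet a b c d e f x :
  differentiable (exp_jet a b c d e f) x.
Proof.
have dcoord (j : 'I_5) : differentiable (fun y : jet1 R => y 0 j) x.
  exact: differentiable_coord.
have dexp (k : R) : differentiable (fun y : jet1 R => expR (k * y 0 jw)) x.
  apply: (@differentiable_comp _ _ _ _ (fun y : jet1 R => k * y 0 jw) expR).
    exact: differentiableM.
  exact/derivable1_diffP/derivable_expR.
have dexp1 : differentiable (fun y : jet1 R => expR (y 0 jw)) x.
  by have := dexp 1; under eq_fun do rewrite mul1r.
by do ?[apply: differentiableD | apply: differentiableM].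
Qed.

(** The derivative is regrouped into members of the same family, so that each direction acts on the
    coefficients alone. *)
Lemma is_derive_exp_jet a b c d e f x v :
  is_derive x v (exp_jet a b c d e f)
    (v 0 jwu * exp_jet 0 0 a b 0 0 x + v 0 jwv * exp_jet 0 a 0 c 0 0 x
     + v 0 jw * exp_jet 0 0 0 0 e (- 2 * f) x).
Proof.
have dwu := is_derive_coord x v 0 jwu.
have dwv := is_derive_coord x v 0 jwv.
have dw := is_derive_coord x v 0 jw.
have d2w : is_derive x v (fun y : jet1 R => - 2 * y 0 jw) (- 2 * v 0 jw).
  exact: (is_deriveZ (- 2) dw).
have de1 := is_derive_expR_comp v (differentiable_coord x 0 jw).
have de2 : is_derive x v (expR \o (fun y : jet1 R => - 2 * y 0 jw))
    (expR (- 2 * x 0 jw) * 'D_v (fun y : jet1 R => - 2 * y 0 jw) x).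
  apply: is_derive_expR_comp; apply: differentiableM => //.
  exact: differentiable_coord.
(* As a combination of functions, [exp_jet] can be differentiated by instance inference from the
   facts above. *)
have -> : exp_jet a b c d e f =
    a \*: ((fun y : jet1 R => y 0 jwu) * (fun y : jet1 R => y 0 jwv))
    + b \*: (fun y : jet1 R => y 0 jwu) + c \*: (fun y : jet1 R => y 0 jwv)
    + cst d + e \*: (expR \o (fun y : jet1 R => y 0 jw))
    + f \*: (expR \o (fun y : jet1 R => - 2 * y 0 jw)).
  by apply/funext => y; rewrite /exp_jet -mulrA.
apply: is_derive_eq.
(* The chain rule left the derivatives of the two exponents unevaluated. *)
rewrite [in LHS](derive_val (is_derive := dw)) (derive_val (is_derive := d2w)).
rewrite /exp_jet /GRing.scale /=; ring.
Qed.

(** An equality of functions, not of values, so that it also rewrites under a further [partial]. *)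
Lemma partial_exp_jet a b c d e f (i : 'I_5) :
  partial i (exp_jet a b c d e f) =
  [:: exp_jet 0 0 0 0 0 0; exp_jet 0 0 0 0 0 0;
      exp_jet 0 0 0 0 e (- 2 * f); exp_jet 0 0 a b 0 0;
      exp_jet 0 a 0 c 0 0]`_i.
Proof.
apply/funext => x.
rewrite /partial (derive_val (is_derive := is_derive_exp_jet a b c d e f x _)).
by case: i => -[|[|[|[|[|//]]]]] ? /=; rewrite !mxE /= /exp_jet; ring.
Qed.

Lemma smooth_exp_jet a b c d e f : smooth (exp_jet a b c d e f).
Proof.
(* The coefficients are generalized because every [partial] changes them. *)
move=> k; elim: k a b c d e f => [|k IHk] a b c d e f; split=> //.
- by move=> x _; apply/differentiable_continuous/differentiable_exp_jet.
- by move=> x _; apply/differentiable_continuous/differentiable_exp_jet.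
move=> i; split=> [x _|]; first exact/diff_derivable/differentiable_exp_jet.
by rewrite partial_exp_jet; case: i => -[|[|[|[|[|//]]]]] ? /=; exact: IHk.
Qed.

(** The mixed term contributes [a] times w_uv through each of the two total derivatives; the terms
    in [b], [c] and [d] form a null Lagrangian. *)
Lemma euler_exp_jet a b c d e f (z : jet2 R) :
  euler (exp_jet a b c d e f) z =
  e * expR (order1 z 0 jw) - 2 * f * expR (- 2 * order1 z 0 jw)
  - 2 * a * order2 z 0 juv.
Proof.
rewrite /euler /total_u /total_v !partial_exp_jet /ju /jv /jw /jwu /jwv /=.
by rewrite /exp_jet /jw; ring.
Qed.

Lemma lagrangian1E : @lagrangian1 R = exp_jet (- (1 / 2)) 0 0 0 (- 1) 0.
Proof. by apply/funext => x; rewrite /lagrangian1 /exp_jet; ring. Qed.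

Lemma lagrangian2E :
  @lagrangian2 R = exp_jet (- (1 / 2)) 0 0 0 (- 1) (- (1 / 2)).
Proof. by apply/funext => x; rewrite /lagrangian2 /exp_jet; ring. Qed.

End ExpJet.

Lemma euler_lagrange_eqP (R : realType) (D : jet2 R -> R) (L : jet1 R -> R) :
  smooth L -> D = euler L -> euler_lagrange_eq D L.
Proof. by move=> sL ->. Qed.

Theorem theorem12 (R : realType) :
  euler_lagrange_eq (@liouville_titeica R) (@lagrangian1 R) /\
  euler_lagrange_eq (@titeica R) (@lagrangian2 R).
Proof.
split; apply: euler_lagrange_eqP.
- by rewrite lagrangian1E; exact: smooth_exp_jet.
(* The factor [- (1 / 2)] turns [- 2 * a] into 1, so the two sides agree with no change of sign. *)
- apply/funext => z; rewrite lagrangian1E euler_exp_jet /liouville_titeica.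
  by field.
- by rewrite lagrangian2E; exact: smooth_exp_jet.
- apply/funext => z; rewrite lagrangian2E euler_exp_jet /titeica.
  by field.
Qed.
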